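(* Let $G$ be any graph with $n$ vertices and suppose $G$ has an RV-representation. Then the following hold. (i) $\operatorname{height}(G)\ge 1$, with equality if and only if $G\cong P_n$, the path on $n$ vertices. (ii) $\operatorname{area}(G)\ge n$, with equality if and only if $G\cong P_h\,\square\,P_w$ for some positive integers $h$ and $w$ with $n=h\cdot w$. (iii) $\operatorname{width}(G)\ge\lceil\sqrt n\,\rceil$, with equality if and only if $G\in\mathcal{F}_{w,w}$ where $w=\lceil\sqrt n\,\rceil$. (iv) $\operatorname{perim}(G)\ge 2\cdot[[\sqrt n]]+2\cdot\lceil\sqrt n\,\rceil$, with equality if and only if $G\in\mathcal{F}_{h,w}$ for some positive integers $h$ and $w$ with $h+w=[[\sqrt n]]+\lceil\sqrt n\,\rceil$ and $hw\ge n$.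
   Context: An integer rectangle is a set $[x_1,x_2]\times[y_1,y_2]$ with $x_1<x_2$, $y_1<y_2$ integers. Let $S$ be a finite nonempty set of integer rectangles with pairwise disjoint interiors (rectangles may share boundary edges). Two rectangles $A,B\in S$ see each other if there is a vertical or horizontal line segment that intersects the interiors of both $A$ and $B$ and intersects no other (closed) rectangle of $S$. $S$ is an RV-representation of a graph $G$ if the vertices of $G$ correspond bijectively to the rectangles of $S$ so that two vertices are adjacent if and only if their rectangles see each other. The bounding box of $S$ is the smallest axis-parallel rectangle $R$ containing all rectangles of $S$; it is always turned (rotated by $90^\circ$ if necessary) so that its height is at most its width. Thus the height of $R$ is its shorter side length and the width of $R$ is its longer side length. $\operatorname{height}(G)$, $\operatorname{width}(G)$, $\operatorname{area}(G)$, $\operatorname{perim}(G)$ (the perimeter of $G$) are the minimum height, width, area, perimeter, respectively, of the bounding box, each minimum being taken separately over all RV-representations of $G$. For positive integers $h,w$, $\mathcal{F}_{h,w}$ denotes the set of graphs that have an RV-representation in an $h\times w$ bounding box (a box with side lengths $h$ and $w$; by rotation $\mathcal{F}_{h,w}=\mathcal{F}_{w,h}$). $P_h\,\square\,P_w$ is the Cartesian product of paths on $h$ and $w$ vertices (grid graph). For real $x$, $[[x]]=\lfloor x+1/2\rfloor$ is $x$ rounded to the nearest integer. *)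

(* Defs.v *)
From HB Require Import structures.
From mathcomp Require Import all_boot all_order all_algebra finmap.
From mathcomp Require Import all_classical all_reals all_analysis.
Set Implicit Arguments.
Unset Strict Implicit.
Unset Printing Implicit Defensive.
Import Order.TTheory GRing.Theory Num.Theory.
Import numFieldNormedType.Exports.
Local Open Scope classical_set_scope.
Local Open Scope ring_scope.

(* An integer rectangle is given by its coordinates ((x1, x2), (y1, y2)); the
   subset of the plane R * R that it denotes is [rect_set]. *)
Definition irect : Type :=
  {c : (int * int) * (int * int) | (c.1.1 < c.1.2) && (c.2.1 < c.2.2)}.
HB.instance Definition _ := Choice.on irect.

Definition x1 (A : irect) : int := (val A).1.1.
Definition x2 (A : irect) : int := (val A).1.2.
Definition y1 (A : irect) : int := (val A).2.1.
Definition y2 (A : irect) : int := (val A).2.2.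

Definition side_x (A : irect) : int := x2 A - x1 A.
Definition side_y (A : irect) : int := y2 A - y1 A.

(* The bounding box is turned so that its height is its shorter side. *)
Definition box_height (B : irect) : int := Num.min (side_x B) (side_y B).
Definition box_width (B : irect) : int := Num.max (side_x B) (side_y B).
Definition box_area (B : irect) : int := side_x B * side_y B.
Definition box_perim (B : irect) : int := 2 * side_x B + 2 * side_y B.

(* Only meaningful when [X] has a least element; 0 otherwise. *)
Definition minimum (X : set int) : int := xget 0 (X `&` lbound X).

Section RectangleVisibility.
Variable R : realType.

Definition rect_set (A : irect) : set (R * R) :=
  `[(x1 A)%:~R, (x2 A)%:~R] `*` `[(y1 A)%:~R, (y2 A)%:~R].

Definition axis_segment (s : set (R * R)) : Prop :=
  exists c a b : R, a < b /\ (s = [set c] `*` `[a, b] \/ s = `[a, b] `*` [set c]).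

Definition sees (S : {fset irect}) (A B : irect) : Prop :=
  exists s : set (R * R),
    [/\ axis_segment s,
        s `&` (rect_set A)° !=set0,
        s `&` (rect_set B)° !=set0 &
        forall C, C \in S -> C != A -> C != B -> s `&` rect_set C = set0].

Definition rect_layout (S : {fset irect}) : Prop :=
  S != fset0 /\ trivIset [set` S] (fun A => (rect_set A)°).

(* [B] is the least axis-parallel rectangle, among all those with real
   coordinates, containing the rectangles of [S]. *)
Definition bounding_box (S : {fset irect}) (B : irect) : Prop :=
  (forall A, A \in S -> rect_set A `<=` rect_set B) /\
  (forall a b c d : R,
     (forall A, A \in S -> rect_set A `<=` `[a, b] `*` `[c, d]) ->
     rect_set B `<=` `[a, b] `*` `[c, d]).

Section Graph.
Variables (T : finType) (e : rel T).

Definition rv_representation (S : {fset irect}) : Prop :=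
  rect_layout S /\
  exists f : T -> S, bijective f /\
    forall u v : T, u != v -> (e u v <-> sees S (val (f u)) (val (f v))).

Definition rv_box (B : irect) : Prop :=
  exists S : {fset irect}, rv_representation S /\ bounding_box S B.

Definition height : int := minimum [set box_height B | B in rv_box].
Definition width : int := minimum [set box_width B | B in rv_box].
Definition area : int := minimum [set box_area B | B in rv_box].
Definition perim : int := minimum [set box_perim B | B in rv_box].

Definition in_F (h w : int) : Prop :=
  exists2 B, rv_box B &
    (side_y B = h /\ side_x B = w) \/ (side_y B = w /\ side_x B = h).

End Graph.

Definition round (x : R) : int := Num.floor (x + 2^-1).

End RectangleVisibility.

Definition graph_iso (T T' : finType) (e : rel T) (e' : rel T') : Prop :=
  exists f : T -> T', bijective f /\ forall u v, e u v = e' (f u) (f v).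

Definition path_graph (n : nat) : rel 'I_n :=
  fun i j => (i.+1 == j :> nat) || (j.+1 == i :> nat).

Definition cart_prod (T T' : finType) (e : rel T) (e' : rel T') : rel (T * T') :=
  fun p q => (p.1 == q.1) && e' p.2 q.2 || (p.2 == q.2) && e p.1 q.1.

(* Main.v *)
Require Import Defs.
From mathcomp Require Import all_boot all_order all_algebra finmap.
From mathcomp Require Import all_classical all_reals all_analysis.
From mathcomp Require Import zify lra ring.
Set Implicit Arguments.
Unset Strict Implicit.
Unset Printing Implicit Defensive.
Import Order.TTheory GRing.Theory Num.Theory.
Import numFieldNormedType.Exports.
Local Open Scope ring_scope.

(** Visibility between rectangles with integer corners is a matter of finitely
    many rows and columns.  A horizontal line of sight at height c can be moved
    to the middle of the unit row containing c, since a closed rectangle meeting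
    that row at its middle also meets the line at c; and two non-overlapping
    rectangles of a row see each other inside it exactly when no other rectangle
    of the row lies between them ([sees_in_rowP]).  This replaces the plane by
    the order of the left sides in each row; columns are handled by exchanging
    the coordinates ([rv_representationP], [rv_boxP]).

    All four lower bounds come from area.  Sending each rectangle to the unit
    square in its bottom left corner is injective, so a box of sides h and w
    satisfies n <= h * w ([card_le_area]).  For the width, n <= w * w.  For the
    perimeter, (h + w)^2 >= 4 h w >= 4 n gives h + w >= 2 sqrt n, and the rounding
    in [round_ceil_sqrt_le] is settled by parity: 4 n is not an odd square.

    Equality cases.  In a box of height 1 the rectangles are linearly ordered and
    each sees just its neighbours, so the graph is a path ([row_visible]).  In a
    box of area n the corner squares fill the box, so that every rectangle is a
    unit square and the graph is the grid ([full_box_unit_cells],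
    [unit_cells_visible]); conversely an array of unit squares realises any grid,
    and a path is the grid with one row ([grid_rv_box]).  For the width, a
    representation in a box whose longer side is w can be padded to a w by w box:
    lengthening the rectangles that touch the top side of the box changes no
    visibility ([stretch_top]). *)

(** * Rectangles and visibility in rows and columns *)

Definition mk_rect (a b c d : int) (lt_ab : a < b) (lt_cd : c < d) : irect :=
  exist _ ((a, b), (c, d)) (introT andP (conj lt_ab lt_cd)).

Lemma x_lt (A : irect) : x1 A < x2 A.
Proof. by case/andP: (valP A). Qed.

Lemma y_lt (A : irect) : y1 A < y2 A.
Proof. by case/andP: (valP A). Qed.

Definition transpose (A : irect) : irect := mk_rect (y_lt A) (x_lt A).

Lemma transposeE (A : irect) :
  (x1 (transpose A) = y1 A) * (x2 (transpose A) = y2 A) *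
  (y1 (transpose A) = x1 A) * (y2 (transpose A) = x2 A).
Proof. by []. Qed.

Definition non_overlapping (A B : irect) : bool :=
  [|| x2 A <= x1 B, x2 B <= x1 A, y2 A <= y1 B | y2 B <= y1 A].

Definition in_row (k : int) (A : irect) : bool := y1 A <= k < y2 A.

Section Families.
Variable T : finType.
Implicit Type r : T -> irect.

Definition packing r : Prop := forall u v, u != v -> non_overlapping (r u) (r v).

(** Discrete form of a horizontal line of sight, running in the middle of the
    unit row between the heights k and k + 1.  Since the rectangles crossing a row
    do not overlap, comparing left sides is enough to tell which one lies between
    two others. *)
Definition sees_in_row r (u v : T) : Prop :=
  exists k : int, [/\ in_row k (r u), in_row k (r v) &
    forall w, in_row k (r w) ->
      ~~ (x1 (r u) < x1 (r w) < x1 (r v)) /\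
      ~~ (x1 (r v) < x1 (r w) < x1 (r u))].

Definition sees_in_column r : T -> T -> Prop :=
  sees_in_row (transpose \o r).

Definition visible r (u v : T) : Prop :=
  sees_in_row r u v \/ sees_in_column r u v.

Definition represents (e : rel T) r : Prop :=
  packing r /\ forall u v, u != v -> (e u v <-> visible r u v).

Definition in_box r (B : irect) : Prop := forall u,
  [/\ x1 B <= x1 (r u), x2 (r u) <= x2 B, y1 B <= y1 (r u) & y2 (r u) <= y2 B].

Definition tight_box r (B : irect) : Prop :=
  in_box r B /\
  [/\ exists u, x1 (r u) = x1 B, exists u, x2 (r u) = x2 B,
      exists u, y1 (r u) = y1 B & exists u, y2 (r u) = y2 B].

Lemma packing_transpose r : packing r -> packing (transpose \o r).
Proof. by move=> pk u v /pk; rewrite /non_overlapping /= !transposeE; lia. Qed.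

Lemma visible_transpose r u v : visible (transpose \o r) u v <-> visible r u v.
Proof. by rewrite /visible; split=> -[] h; [right | left | right | left]. Qed.

Lemma represents_transpose e r : represents e r -> represents e (transpose \o r).
Proof.
move=> [pk vis]; split; first exact: packing_transpose.
by move=> u v /vis uv; rewrite visible_transpose.
Qed.

Lemma tight_box_transpose r B :
  tight_box r B -> tight_box (transpose \o r) (transpose B).
Proof. by move=> [sub [l ri b t]]; split=> [u|]; [case: (sub u) | split]. Qed.

(** * Padding a representation *)

Lemma stretch_subproof (t k : int) (A : irect) : 0 <= k ->
  y1 A < (if y2 A == t then y2 A + k else y2 A).
Proof. by have := y_lt A; case: ifP; lia. Qed.

(** Raises the top side of [A] by [k] when it lies at height [t]. *)
Definition stretch (t k : int) (k_ge0 : 0 <= k) (A : irect) : irect :=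
  mk_rect (x_lt A) (stretch_subproof t A k_ge0).

Lemma stretchE t k (k_ge0 : 0 <= k) A :
  (x1 (stretch t k_ge0 A) = x1 A) * (x2 (stretch t k_ge0 A) = x2 A) *
  (y1 (stretch t k_ge0 A) = y1 A) *
  (y2 (stretch t k_ge0 A) = if y2 A == t then y2 A + k else y2 A).
Proof. by []. Qed.

(** Only top sides move.  Columns are ordered by bottom sides, so nothing changes
    there; in a row below the old top the same rectangles are present, and every
    added row contains the same rectangles as the old topmost row. *)
Lemma stretch_top r B k (k_ge0 : 0 <= k) : packing r -> tight_box r B ->
  let r' := stretch (y2 B) k_ge0 \o r in
  [/\ packing r', tight_box r' (stretch (y2 B) k_ge0 B) &
      forall u v, visible r' u v <-> visible r u v].
Proof.
move=> pk [sub [ex1 ex2 ey1 ey2]] /=.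
have top u : y2 (r u) <= y2 B by case: (sub u).
split.
- move=> u v uv; have := pk _ _ uv; rewrite /non_overlapping /= !stretchE.
  have := top u; have := top v; have := y_lt (r u); have := y_lt (r v).
  by do 2 case: ifP; lia.
- split=> [u|].
    case: (sub u) => h1 h2 h3 h4; split=> //=.
    by rewrite !stretchE eqxx; case: ifP; lia.
  split=> //; case: ey2 => u yu; exists u => /=.
  by rewrite !stretchE yu eqxx.
- (* Row j of the stretched family corresponds to row i of the original one. *)
  have row_eq i j u :
      (if j < y2 B then i = j else i = y2 B - 1 /\ j < y2 B + k) ->
      in_row j (stretch (y2 B) k_ge0 (r u)) = in_row i (r u).
    move=> ij; rewrite /in_row !stretchE; have := top u; have := y_lt (r u).
    by move: ij; do 2 case: ifP; lia.
  move=> u v; split=> -[[j [ju jv jb]]|]; [left | by right | left | by right].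
  + exists (if j < y2 B then j else y2 B - 1).
    have E w : in_row j (stretch (y2 B) k_ge0 (r w)) =
        in_row (if j < y2 B then j else y2 B - 1) (r w).
      apply: row_eq; case jt: (j < y2 B) => //; split=> //.
      move: ju; rewrite /in_row /= !stretchE; have := top u; by case: ifP; lia.
    by rewrite -!E; split=> // w; rewrite -E => /jb.
  + have jt : j < y2 B by have := top u; move: ju; rewrite /in_row; lia.
    have E w : in_row j (stretch (y2 B) k_ge0 (r w)) = in_row j (r w).
      by apply: row_eq; rewrite jt.
    by exists j; rewrite /= !E; split=> // w; rewrite E => /jb.
Qed.

(** * Counting corner squares *)

(** Two rectangles with the same bottom left corner overlap. *)
Lemma bottom_left_corners r B : packing r -> in_box r B ->
  exists2 f : T -> 'I_(`|side_y B|) * 'I_(`|side_x B|), injective f &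
    forall u, x1 (r u) = x1 B + ((f u).2 : nat)%:Z /\
              y1 (r u) = y1 B + ((f u).1 : nat)%:Z.
Proof.
move=> pk sub.
have py u : (`|y1 (r u) - y1 B| < `|side_y B|)%N.
  by case: (sub u) => *; have := y_lt (r u); rewrite /side_y; lia.
have px u : (`|x1 (r u) - x1 B| < `|side_x B|)%N.
  by case: (sub u) => *; have := x_lt (r u); rewrite /side_x; lia.
have E u : x1 (r u) = x1 B + `|x1 (r u) - x1 B|%N%:Z /\
           y1 (r u) = y1 B + `|y1 (r u) - y1 B|%N%:Z.
  by case: (sub u) => *; split; lia.
exists (fun u => (Ordinal (py u), Ordinal (px u))) => [u v [ey ex]|//].
apply/eqP; apply: contraT => /pk; rewrite /non_overlapping.
have [ux uy] := E u; have [vx vy] := E v.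
have := x_lt (r u); have := x_lt (r v); have := y_lt (r u); have := y_lt (r v).
lia.
Qed.

Lemma card_le_area r B : packing r -> in_box r B -> #|T|%:Z <= box_area B.
Proof.
move=> pk sub; have [f inj_f _] := bottom_left_corners pk sub.
have := leq_card f inj_f; rewrite card_prod !card_ord /box_area.
by have := x_lt B; have := y_lt B; rewrite /side_x /side_y; nia.
Qed.

Definition unit_cells r h w (f : T -> 'I_h * 'I_w) (x y : int) : Prop :=
  forall u, [/\ x1 (r u) = x + ((f u).2 : nat)%:Z, x2 (r u) = x1 (r u) + 1,
                y1 (r u) = y + ((f u).1 : nat)%:Z & y2 (r u) = y1 (r u) + 1].

(** By counting, every unit square of the box is the bottom left corner of some
    rectangle; so a rectangle longer than 1 would cover the corner square next to
    its own, which belongs to another rectangle. *)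
Lemma full_box_unit_cells r B :
  packing r -> in_box r B -> box_area B = #|T|%:Z ->
  exists2 f : T -> 'I_(`|side_y B|) * 'I_(`|side_x B|), bijective f &
    unit_cells r f (x1 B) (y1 B).
Proof.
move=> pk sub areaB; have [f inj_f fE] := bottom_left_corners pk sub.
have bij_f : bijective f.
  apply: inj_card_bij => //; rewrite card_prod !card_ord -lez_nat -areaB PoszM.
  by rewrite mulrC !gez0_abs // /side_x /side_y subr_ge0 ltW ?x_lt ?y_lt.
exists f => // u; have [g fK gK] := bij_f.
have [xu yu] := fE u; have [b1 b2 b3 b4] := sub u.
(* The corner squares of the other rectangles lie outside u. *)
have free v : v != u -> ~~ in_row (y1 (r v)) (r u) \/
                        ~~ in_row (x1 (r v)) (transpose (r u)).
  move=> /pk; rewrite /non_overlapping /in_row !transposeE.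
  by have := x_lt (r v); have := y_lt (r v); lia.
have xlt := x_lt (r u); have ylt := y_lt (r u).
have wB : `|side_x B|%N%:Z = x2 B - x1 B by rewrite gez0_abs // subr_ge0 ltW ?x_lt.
have hB : `|side_y B|%N%:Z = y2 B - y1 B by rewrite gez0_abs // subr_ge0 ltW ?y_lt.
split=> //; apply/eqP; apply: contraT => big.
- have px : ((f u).2.+1 < `|side_x B|)%N by lia.
  have := fE (g ((f u).1, Ordinal px)); rewrite gK /= => -[xv yv].
  have /free : g ((f u).1, Ordinal px) != u.
    by apply: contra_eqN xv => /eqP ->; lia.
  by rewrite /in_row !transposeE; lia.
- have py : ((f u).1.+1 < `|side_y B|)%N by lia.
  have := fE (g (Ordinal py, (f u).2)); rewrite gK /= => -[xv yv].
  have /free : g (Ordinal py, (f u).2) != u.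
    by apply: contra_eqN yv => /eqP ->; lia.
  by rewrite /in_row !transposeE; lia.
Qed.

(** * Arrays of unit squares are grids *)

Lemma unit_cells_row r h w (f : T -> 'I_h * 'I_w) x y u v :
  bijective f -> unit_cells r f x y -> u != v ->
  sees_in_row r u v <-> (f u).1 = (f v).1 /\ path_graph (f u).2 (f v).2.
Proof.
move=> [g fK gK] cells uv; rewrite /path_graph.
have fuv : f u != f v by rewrite (can_eq fK).
have [ux1 ux2 uy1 uy2] := cells u; have [vx1 vx2 vy1 vy2] := cells v.
split=> [[k [ku kv kb]]|[e1 /orP adj]].
- have e1 : (f u).1 = (f v).1.
    by apply: val_inj; move: ku kv; rewrite /in_row /=; lia.
  have e2 : (f u).2 != (f v).2 :> nat.
    by apply: contra fuv => /eqP/val_inj e2; rewrite -pair_eqE /pair_eq e1 e2 !eqxx.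
  split=> //; apply: contraT => nadj.
  (* As the columns of u and v are at distance at least 2, the square next to the
     left one of them is strictly between them. *)
  pose m := (minn (f u).2 (f v).2).+1.
  have mw : (m < w)%N by rewrite /m; have := ltn_ord (f u).2; have := ltn_ord (f v).2; lia.
  have [] := cells (g ((f u).1, Ordinal mw)); rewrite gK /= => x1' x2' y1' y2'.
  have /kb : in_row k (r (g ((f u).1, Ordinal mw))).
    by move: ku; rewrite /in_row; lia.
  by rewrite x1' ux1 vx1 /m; lia.
- exists (y1 (r u)); rewrite /in_row vy2 vy1 uy2 uy1 -e1; split; [lia | lia | move=> z _].
  by have [-> _ _ _] := cells z; rewrite ux1 vx1; case: adj; lia.
Qed.

Lemma unit_cells_transpose r h w (f : T -> 'I_h * 'I_w) x y :
  unit_cells r f x y -> unit_cells (transpose \o r) (fun u => ((f u).2, (f u).1)) y x.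
Proof. by move=> cells u; have [] := cells u. Qed.

Lemma unit_cells_visible r h w (f : T -> 'I_h * 'I_w) x y u v :
  bijective f -> unit_cells r f x y -> u != v ->
  visible r u v <-> cart_prod (@path_graph h) (@path_graph w) (f u) (f v).
Proof.
move=> bij_f cells uv; rewrite /visible (unit_cells_row bij_f cells uv).
have bij_g : bijective (fun u => ((f u).2, (f u).1)).
  have [g fK gK] := bij_f; exists (fun p => g (p.2, p.1)) => [z|[i j]] /=.
    by rewrite -surjective_pairing fK.
  by rewrite gK.
rewrite /sees_in_column (unit_cells_row bij_g (unit_cells_transpose cells) uv).
rewrite /cart_prod /=; split=> [[[-> ->]|[-> ->]]|/orP[/andP[/eqP]|/andP[/eqP]]];
  rewrite ?eqxx ?orbT //; by [left | right].
Qed.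

(** * One row of rectangles is a path *)

(** The rank of [u] counts the values below that of [u]. *)
Lemma order_rank (g : T -> int) : injective g ->
  exists2 f : T -> 'I_#|T|, bijective f &
    forall u v, (f u < f v)%N = (g u < g v).
Proof.
move=> inj_g; pose below u := [pred z | g z < g u].
have lt u : (#|below u| < #|T|)%N.
  apply: proper_card; apply/properP; split; first exact/subset_predT.
  by exists u; rewrite // inE ltxx.
have mono u v : g u < g v -> (#|below u| < #|below v|)%N.
  move=> uv; apply: proper_card; apply/properP; split.
    by apply/fintype.subsetP => z; rewrite !inE => /lt_trans; apply.
  by exists u; rewrite !inE // ltxx.
have E u v : (#|below u| < #|below v|)%N = (g u < g v).
  apply/idP/idP => [uv|/mono //]; case: (ltgtP (g u) (g v)) => // [/mono|/inj_g eq_uv].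
    by lia.
  by move: uv; rewrite eq_uv ltnn.
exists (fun u => Ordinal (lt u)) => // ; apply: inj_card_bij; last by rewrite card_ord.
move=> u v [euv]; apply: inj_g; have := E u v; have := E v u.
by rewrite euv ltnn; case: ltgtP.
Qed.

(** All rectangles cross the only row, so they are ordered from left to right and
    no two of them share a column; consecutive ranks mean nothing in between. *)
Lemma row_visible r B : packing r -> in_box r B -> side_y B = 1 ->
  exists2 f : T -> 'I_#|T|, bijective f &
    forall u v, u != v -> visible r u v <-> path_graph (f u) (f v).
Proof.
rewrite /side_y => pk sub hB.
have yE u : y1 (r u) = y1 B /\ y2 (r u) = y1 B + 1.
  by have [] := sub u; have := y_lt (r u); lia.
have sep u v : u != v -> x2 (r u) <= x1 (r v) \/ x2 (r v) <= x1 (r u).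
  by move=> /pk; rewrite /non_overlapping; have [-> ->] := yE u; have [-> ->] := yE v; lia.
have inj_x : injective (x1 \o r).
  move=> u v /= euv; apply/eqP; apply: contraT => /sep.
  by have := x_lt (r u); have := x_lt (r v); lia.
have [f bij_f fE] := order_rank inj_x; exists f => // u v uv.
have [g fK gK] := bij_f.
have fuv : f u != f v :> nat.
  by apply: contra uv => /eqP/val_inj/(can_inj fK) ->.
rewrite /path_graph; split=> [[[k [ku kv kb]]|[k [ku kv _]]]|/orP adj].
- apply: contraT => nadj; pose m := (minn (f u) (f v)).+1.
  have mT : (m < #|T|)%N by rewrite /m; have := ltn_ord (f u); have := ltn_ord (f v); lia.
  have fz : f (g (Ordinal mT)) = m :> nat by rewrite gK.
  have /kb : in_row k (r (g (Ordinal mT))).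
    move: ku; rewrite /in_row; have [-> ->] := yE u.
    by have [-> ->] := yE (g (Ordinal mT)).
  by rewrite -!fE fz /m; lia.
- move: ku kv; rewrite /in_row /= !transposeE; have := sep _ _ uv; lia.
- left; exists (y1 B); rewrite /in_row; have [-> ->] := yE u.
  have [-> ->] := yE v; split; [lia | lia | move=> z _].
  by rewrite -!fE; case: adj; lia.
Qed.

End Families.

(** * From the plane to rows *)

Section Plane.
Local Open Scope classical_set_scope.
Variable R : realType.
Implicit Types A B : irect.

Lemma interior_rect A (p : R * R) : (@rect_set R A)° p <->
  ((x1 A)%:~R < p.1 < (x2 A)%:~R) /\ ((y1 A)%:~R < p.2 < (y2 A)%:~R).
Proof.
have itv (a b : R) : `[a, b]%classic° = `]a, b[%classic by exact: interior_itv_bnd.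
have itvE (a b x : R) : `[a, b]%classic° x <-> a < x < b by rewrite itv /= in_itv.
rewrite -!itvE; split.
  case=> -[U V] /= [nU nV] UV; split; [apply: filterS nU|apply: filterS nV].
    by move=> x Ux; have [] := UV (x, p.2) (conj Ux (nbhs_singleton nV)).
  by move=> y Vy; have [] := UV (p.1, y) (conj (nbhs_singleton nU) Vy).
by move=> [n1 n2]; exists (`[(x1 A)%:~R, (x2 A)%:~R], `[(y1 A)%:~R, (y2 A)%:~R]).
Qed.

Lemma le_intR (a b : int) : (a <= b) = (a%:~R <= b%:~R :> R).
Proof. by rewrite ler_int. Qed.

Lemma lt_intR (a b : int) : (a < b) = (a%:~R < b%:~R :> R).
Proof. by rewrite ltr_int. Qed.

Lemma lt_intR1 (a b : int) : a < b -> a%:~R + 1 <= b%:~R :> R.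
Proof. by rewrite -lezD1 le_intR intrD. Qed.

Lemma non_overlappingP A B :
  non_overlapping A B <-> (@rect_set R A)° `&` (@rect_set R B)° = set0.
Proof.
split=> [sep|disj].
  rewrite -subset0 => p [/interior_rect[pA1 pA2] /interior_rect[pB1 pB2]].
  by move: sep; rewrite /non_overlapping !le_intR; lra.
apply: contraT; rewrite /non_overlapping => sep.
(* The bottom left corner of the overlap of A and B, moved by 1/2 in each
   direction, is interior to both. *)
pose p : R * R := ((Num.max (x1 A) (x1 B))%:~R + 2^-1, (Num.max (y1 A) (y1 B))%:~R + 2^-1).
have mid (a b c : int) : a <= b -> b < c -> a%:~R < (b%:~R + 2^-1 : R) < c%:~R.
  by rewrite le_intR => ab /lt_intR1; lra.
suff : ((@rect_set R A)° `&` (@rect_set R B)°) p by rewrite disj.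
have := x_lt A; have := x_lt B; have := y_lt A; have := y_lt B => *.
by split; apply/interior_rect; split; apply: mid; lia.
Qed.

Section Segments.
Variable T : finType.
Implicit Type r : T -> irect.

(** A line of sight along a horizontal segment, with the points where it meets the
    two interiors made explicit. *)
Definition clear_segment r (u v : T) : Prop := exists c a b : R,
  [/\ a < b,
      exists2 p, a <= p <= b & (@rect_set R (r u))° (p, c),
      exists2 q, a <= q <= b & (@rect_set R (r v))° (q, c) &
      forall w, w != u -> w != v ->
        forall t, a <= t <= b -> ~ @rect_set R (r w) (t, c)].

Lemma rect_setE A (p : R * R) : @rect_set R A p <->
  ((x1 A)%:~R <= p.1 <= (x2 A)%:~R) /\ ((y1 A)%:~R <= p.2 <= (y2 A)%:~R).
Proof. by rewrite /rect_set /= !in_itv. Qed.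

Lemma rect_set_transpose A (p : R * R) :
  @rect_set R (transpose A) p <-> @rect_set R A (p.2, p.1).
Proof. by rewrite !rect_setE !transposeE /=; split; case. Qed.

Lemma interior_rect_transpose A (p : R * R) :
  (@rect_set R (transpose A))° p <-> (@rect_set R A)° (p.2, p.1).
Proof. by rewrite !interior_rect !transposeE /=; split; case. Qed.

Lemma clear_segment_sym r u v : clear_segment r u v -> clear_segment r v u.
Proof. by move=> [c [a [b [ab eu ev cl]]]]; exists c, a, b; split=> // w *; exact: cl. Qed.

Lemma sees_in_row_sym r u v : sees_in_row r u v -> sees_in_row r v u.
Proof. by move=> [k [ku kv cl]]; exists k; split=> // w /cl[]. Qed.

Lemma same_row r k u v : packing r -> u != v -> in_row k (r u) -> in_row k (r v) ->
  x2 (r u) <= x1 (r v) \/ x2 (r v) <= x1 (r u).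
Proof. by move=> pk /pk; rewrite /non_overlapping /in_row; lia. Qed.

(** The segment joins the points at distance 1/2 to the right of the two left
    sides, at the middle of the row, where no closed rectangle of another row
    reaches. *)
Lemma clear_segment_left r u v : packing r -> u != v -> x2 (r u) <= x1 (r v) ->
  sees_in_row r u v -> clear_segment r u v.
Proof.
move=> pk uv le_uv [k [ku kv cl]].
have ux := lt_intR1 (x_lt (r u)); have vx := lt_intR1 (x_lt (r v)).
have le_uvR : (x2 (r u))%:~R <= (x1 (r v))%:~R :> R by rewrite ler_int.
have in_rowR w : in_row k (r w) -> (y1 (r w))%:~R < (k%:~R + 2^-1 : R) < (y2 (r w))%:~R.
  by case/andP; rewrite le_intR => ? /lt_intR1; lra.
exists (k%:~R + 2^-1), ((x1 (r u))%:~R + 2^-1), ((x1 (r v))%:~R + 2^-1); split.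
- by lra.
- exists ((x1 (r u))%:~R + 2^-1); first by lra.
  by apply/interior_rect; split=> /=; [lra | exact: in_rowR].
- exists ((x1 (r v))%:~R + 2^-1); first by lra.
  by apply/interior_rect; split=> /=; [lra | exact: in_rowR].
- move=> w wu wv t tab /rect_setE /= [tw yw].
  have kw : in_row k (r w).
    apply/andP; split.
      by rewrite leNgt; apply/negP => /lt_intR1; lra.
    by rewrite ltNge; apply/negP; rewrite le_intR; lra.
  have [clw _] := cl _ kw.
  have uw : u != w by rewrite eq_sym.
  have [uw'|] := same_row pk uw ku kw; last by rewrite le_intR; lra.
  have [|vw] := same_row pk wv kw kv; last first.
    by move: vw; rewrite le_intR; lra.
  by move=> wv'; case/negP: clw; rewrite (lt_le_trans (x_lt _) uw') (lt_le_trans (x_lt _) wv').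
Qed.

Lemma floor_in_row A p c : (@rect_set R A)° (p, c) -> in_row (Num.floor c) A.
Proof.
move=> /interior_rect[_ /= /andP[lo hi]].
by rewrite /in_row floor_ge_int ltW //= floor_lt_int.
Qed.

(** A rectangle of the row of the segment lying between the two others meets the
    segment, since the segment runs from one interior to the other. *)
Lemma sees_in_row_left r u v : packing r -> u != v -> x2 (r u) <= x1 (r v) ->
  clear_segment r u v -> sees_in_row r u v.
Proof.
move=> pk uv le_uv [c [a [b [ab [p pab pu] [q qab qv] cl]]]].
have ku := floor_in_row pu; have kv := floor_in_row qv.
exists (Num.floor c); split=> // w kw.
have := x_lt (r u); have := x_lt (r v) => xv xu.
split; last by lia.
apply/negP => /andP[uw vw].
have wu : w != u by apply: contraTneq uw => ->; rewrite ltxx.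
have wv : w != v by apply: contraTneq vw => ->; rewrite ltxx.
have uw' : x2 (r u) <= x1 (r w).
  have := same_row pk wu kw ku; have := x_lt (r w); lia.
move: pu qv => /interior_rect[/= pu _] /interior_rect[/= qv _].
apply: (cl w wu wv (x1 (r w))%:~R).
  by move: uw' vw; rewrite le_intR lt_intR; lra.
apply/rect_setE => /=; rewrite lexx ler_int ltW ?x_lt //=; split=> //.
move: kw; rewrite /in_row floor_ge_int floor_lt_int; lra.
Qed.

Lemma sees_in_rowP r u v : packing r -> u != v ->
  sees_in_row r u v <-> clear_segment r u v.
Proof.
move=> pk uv; split=> seen.
  have [k [ku kv _]] := seen; have [uv_lr|vu_lr] := same_row pk uv ku kv.
    exact: clear_segment_left.
  apply/clear_segment_sym/clear_segment_left => //; first by rewrite eq_sym.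
  exact: sees_in_row_sym.
have [c [a [b [_ [p _ pu] [q _ qv] _]]]] := seen.
have [uv_lr|vu_lr] := same_row pk uv (floor_in_row pu) (floor_in_row qv).
  exact: sees_in_row_left.
apply/sees_in_row_sym/sees_in_row_left => //; first by rewrite eq_sym.
exact: clear_segment_sym.
Qed.

(** Vertical segments become horizontal after exchanging the coordinates. *)
Lemma sees_visible (S : {fset irect}) r u v :
  injective r -> (forall A, A \in S <-> exists w, A = r w) -> packing r ->
  u != v -> sees R S (r u) (r v) <-> visible r u v.
Proof.
move=> inj_r memS pk uv; rewrite /visible /sees_in_column.
rewrite !sees_in_rowP //; last exact: packing_transpose.
split.
  case=> s [[c [a [b [ab [|]]]]] -> [[p1 p2] [[/= ph pv]]] pu [[q1 q2] [[/= qh qv]]] qv' cl].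
  - right; exists c, a, b; split=> //.
    + exists p2; first by move: pv; rewrite in_itv.
      by apply/interior_rect_transpose; rewrite /= -ph.
    + exists q2; first by move: qv; rewrite in_itv.
      by apply/interior_rect_transpose; rewrite /= -qh.
    + move=> w wu wv t tab /rect_set_transpose /= wt.
      have /seteqP[+ _] : [set c] `*` `[a, b] `&` @rect_set R (r w) = set0.
        apply: cl; first by apply/memS; exists w.
          by rewrite (inj_eq inj_r).
        by rewrite (inj_eq inj_r).
      by apply; split; last exact: wt; split=> //=; rewrite in_itv.
  - left; exists c, a, b; split=> //.
    + exists p1; first by move: ph; rewrite in_itv.
      by rewrite -pv.
    + exists q1; first by move: qh; rewrite in_itv.
      by rewrite -qv.
    + move=> w wu wv t tab wt.
      have /seteqP[+ _] : `[a, b] `*` [set c] `&` @rect_set R (r w) = set0.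
        apply: cl; first by apply/memS; exists w.
          by rewrite (inj_eq inj_r).
        by rewrite (inj_eq inj_r).
      by apply; split; last exact: wt; split=> //=; rewrite in_itv.
case=> -[c [a [b [ab [p pab pu] [q qab qv] cl]]]].
- exists (`[a, b] `*` [set c]); split.
  + by exists c, a, b; split=> //; right.
  + by exists (p, c); split=> //; split=> //=; rewrite in_itv.
  + by exists (q, c); split=> //; split=> //=; rewrite in_itv.
  + move=> C /memS[w ->]; rewrite !(inj_eq inj_r) => wu wv.
    rewrite -subset0 => -[t c'] [[/= tab ->]] wt.
    by apply: (cl w wu wv t) => //; move: tab; rewrite in_itv.
- exists ([set c] `*` `[a, b]); split.
  + by exists c, a, b; split=> //; left.
  + exists (c, p); split; first by split=> //=; rewrite in_itv.
    by move: pu => /interior_rect_transpose.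
  + exists (c, q); split; first by split=> //=; rewrite in_itv.
    by move: qv => /interior_rect_transpose.
  + move=> C /memS[w ->]; rewrite !(inj_eq inj_r) => wu wv.
    rewrite -subset0 => -[c' t] [[/= -> tab]] wt.
    apply: (cl w wu wv t); first by move: tab; rewrite in_itv.
    exact/rect_set_transpose.
Qed.

Lemma packing_inj r : packing r -> injective r.
Proof.
move=> pk u v euv; apply/eqP; apply: contraT => /pk; rewrite euv /non_overlapping.
by have := x_lt (r v); have := y_lt (r v); lia.
Qed.

Lemma packingP (S : {fset irect}) r : 
  injective r -> (forall A, A \in S <-> exists w, A = r w) ->
  packing r <-> trivIset [set` S] (fun A => (@rect_set R A)°).
Proof.
move=> inj_r memS; split=> [pk A B /= /memS[u ->] /memS[v ->] [p]|triv u v uv].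
  have [->//|/pk/non_overlappingP disj] := eqVneq u v.
  by rewrite disj.
apply/non_overlappingP; apply/eqP; apply: contraT => /set0P ne.
have := triv (r u) (r v); rewrite /= => /(_ _ _ ne).
have -> : r u \in S by apply/memS; exists u.
have -> : r v \in S by apply/memS; exists v.
by move=> /(_ isT isT) /inj_r/eqP; rewrite (negPf uv).
Qed.

Lemma rv_representationP (e : rel T) (S : {fset irect}) :
  rv_representation R e S <->
  [/\ (0 < #|T|)%N & exists2 r, represents e r &
    forall A, A \in S <-> exists w, A = r w].
Proof.
split.
  move=> [[S0 triv] [f [[g fK gK] vis]]].
  pose r u := val (f u).
  have inj_r : injective r by move=> u v /val_inj/(can_inj fK).
  have memS A : A \in S <-> exists w, A = r w.
    split=> [AS|[w ->]]; last exact: valP.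
    by exists (g [` AS]%fset); rewrite /r gK.
  split.
    have [A /memS[w _]] := fset0Pn _ S0.
    by apply/card_gt0P; exists w.
  have pk : packing r by apply/packingP.
  by exists r => //; split=> // u v uv; rewrite (vis _ _ uv); exact: sees_visible.
move=> [T0 [r [pk vis] memS]].
have inj_r := packing_inj pk.
have rS u : r u \in S by apply/memS; exists u.
split.
  split; last by apply/(packingP inj_r memS).
  by have [u _] := card_gt0P T0; apply/fset0Pn; exists (r u).
exists (fun u => [` rS u]%fset); split.
  have pre (a : S) : exists w, val a = r w by apply/memS; exact: valP.
  exists (fun a => projT1 (cid (pre a))) => [u|a].
    by apply: inj_r; case: cid => /= w.
  by apply: val_inj => /=; case: cid => w /= ->.
by move=> u v uv; rewrite (vis _ _ uv); symmetry; exact: sees_visible.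
Qed.

End Segments.
End Plane.

(** * Bounding boxes of representations *)

Section Boxes.
Local Open Scope classical_set_scope.
Variable R : realType.
Implicit Types A B : irect.

Lemma rect_subset A (a b c d : R) :
  rect_set A `<=` `[a, b] `*` `[c, d] <->
  [/\ a <= (x1 A)%:~R, (x2 A)%:~R <= b, c <= (y1 A)%:~R & (y2 A)%:~R <= d].
Proof.
have xA : (x1 A)%:~R <= (x2 A)%:~R :> R by rewrite ler_int ltW ?x_lt.
have yA : (y1 A)%:~R <= (y2 A)%:~R :> R by rewrite ler_int ltW ?y_lt.
split=> [sub|[? ? ? ?] p /rect_setE[px py]]; last by split; rewrite /= in_itv /=; lra.
have /sub[] : @rect_set R A ((x1 A)%:~R, (y1 A)%:~R) by apply/rect_setE => /=; lra.
have /sub[] : @rect_set R A ((x2 A)%:~R, (y2 A)%:~R) by apply/rect_setE => /=; lra.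
by rewrite /= !in_itv /= => /andP[_ ->] /andP[_ ->] /andP[-> _] /andP[-> _].
Qed.

(** A side of the box that no rectangle touches could be moved inwards by 1. *)
Lemma bounding_boxP (T : finType) (S : {fset irect}) (r : T -> irect) B :
  (forall A, A \in S <-> exists w, A = r w) ->
  bounding_box R S B <-> tight_box r B.
Proof.
move=> memS; split=> [[sub least]|[sub [[ul xl] [ur xr] [ub yb] [ut yt]]]].
  have inB : in_box r B.
    move=> u; have /sub : r u \in S by apply/memS; exists u.
    by move=> /rect_subset; rewrite !ler_int.
  split=> //.
  have shrink (i j k l : int) :
      (forall u, [/\ x1 B + i <= x1 (r u), x2 (r u) <= x2 B - j,
                     y1 B + k <= y1 (r u) & y2 (r u) <= y2 B - l]) ->
      [/\ i <= 0, j <= 0, k <= 0 & l <= 0].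
    move=> shr.
    have /rect_subset : rect_set B `<=`
        `[(x1 B + i)%:~R : R, (x2 B - j)%:~R] `*` `[(y1 B + k)%:~R, (y2 B - l)%:~R].
      apply: least => A /memS[u ->]; apply/rect_subset.
      by have [] := shr u; rewrite !ler_int.
    by rewrite !ler_int => -[*]; split; lia.
  split; apply: contrapT => /forallNP no.
  - have [] // := shrink 1 0 0 0 => u; have := no u; have := inB u => -[*]; split; lia.
  - have [] // := shrink 0 1 0 0 => u; have := no u; have := inB u => -[*]; split; lia.
  - have [] // := shrink 0 0 1 0 => u; have := no u; have := inB u => -[*]; split; lia.
  - have [] // := shrink 0 0 0 1 => u; have := no u; have := inB u => -[*]; split; lia.
split=> [A /memS[u ->]|a b c d cov].
  by apply/rect_subset; rewrite !ler_int; exact: sub.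
have {}cov u : [/\ a <= (x1 (r u))%:~R, (x2 (r u))%:~R <= b,
                   c <= (y1 (r u))%:~R & (y2 (r u))%:~R <= d].
  by apply/rect_subset/cov/memS; exists u.
apply/rect_subset; rewrite -xl -xr -yb -yt.
by split; [case: (cov ul) | case: (cov ur) | case: (cov ub) | case: (cov ut)].
Qed.

Section Graph.
Variables (T : finType) (e : rel T).

Lemma rv_boxP B : rv_box R e B <->
  (0 < #|T|)%N /\ exists2 r, represents e r & tight_box r B.
Proof.
split=> [[S [/rv_representationP[T0 [r rep memS]] bb]]|[T0 [r rep tight]]].
  by split=> //; exists r => //; exact/bounding_boxP.
pose S := [fset r u | u in T]%fset.
have memS A : A \in S <-> exists w, A = r w.
  split=> [/imfsetP[w _ ->]|[w ->]]; first by exists w.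
  by apply/imfsetP; exists w.
exists S; split; last by apply/bounding_boxP; [exact: memS|].
by apply/rv_representationP; split=> //; exists r.
Qed.

Lemma rv_box_transpose B : rv_box R e B -> rv_box R e (transpose B).
Proof.
move=> /rv_boxP[T0 [r rep tight]]; apply/rv_boxP; split=> //.
by exists (transpose \o r); [exact: represents_transpose | exact: tight_box_transpose].
Qed.

Lemma rv_box_stretch B (k : int) : 0 <= k -> rv_box R e B ->
  exists B', [/\ rv_box R e B', side_x B' = side_x B & side_y B' = side_y B + k].
Proof.
move=> k_ge0 /rv_boxP[T0 [r [pk vis] tight]].
have [pk' tight' vis'] := stretch_top k_ge0 pk tight.
exists (stretch (y2 B) k_ge0 B); split=> //.
  apply/rv_boxP; split=> //; exists (stretch (y2 B) k_ge0 \o r) => //.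
  by split=> // u v uv; rewrite vis' vis.
by rewrite /side_y !stretchE eqxx addrAC.
Qed.

Lemma rv_box_card B : rv_box R e B -> #|T|%:Z <= box_area B.
Proof. by move=> /rv_boxP[_ [r [pk _] [sub _]]]; exact: (card_le_area pk sub). Qed.

Lemma ex_argmin (g : T -> int) : (0 < #|T|)%N -> exists u, forall v, g u <= g v.
Proof.
by case/card_gt0P => u0 _; case: (arg_minP g (erefl true : xpredT u0)) => u _ le_g; exists u => v; apply: le_g.
Qed.

Lemma rv_box_exists S : rv_representation R e S -> exists B, rv_box R e B.
Proof.
move=> /rv_representationP[T0 [r rep _]].
have [ul xl] := ex_argmin (x1 \o r) T0.
have [ub yb] := ex_argmin (y1 \o r) T0.
have [ur xr] := ex_argmin (fun u => - x2 (r u)) T0.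
have [ut yt] := ex_argmin (fun u => - y2 (r u)) T0.
have xlt : x1 (r ul) < x2 (r ur).
  by have := xr ul; have := x_lt (r ul); lia.
have ylt : y1 (r ub) < y2 (r ut).
  by have := yt ub; have := y_lt (r ub); lia.
exists (mk_rect xlt ylt); apply/rv_boxP; split=> //; exists r => //; split.
  by move=> u; split; [exact: xl | rewrite -lerN2; exact: xr
                      | exact: yb | rewrite -lerN2; exact: yt].
by split; [exists ul | exists ur | exists ub | exists ut].
Qed.

Definition unit_cell (a b : int) : irect := mk_rect (ltrDl a 1) (ltrDl b 1).

Lemma grid_rv_box h w (f : T -> 'I_h * 'I_w) : (0 < #|T|)%N -> bijective f ->
  (forall u v, e u v = cart_prod (@path_graph h) (@path_graph w) (f u) (f v)) ->
  exists B, [/\ rv_box R e B, side_x B = w%:Z & side_y B = h%:Z].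
Proof.
move=> T0 bij_f eE.
pose r u := unit_cell ((f u).2 : nat)%:Z ((f u).1 : nat)%:Z.
have cells : unit_cells r f 0 0 by move=> u; rewrite !add0r.
have [g fK gK] := bij_f; have [u0 _] := card_gt0P T0.
have h0 : (0 < h)%N by apply: leq_ltn_trans (ltn_ord (f u0).1).
have w0 : (0 < w)%N by apply: leq_ltn_trans (ltn_ord (f u0).2).
have h1 : (h.-1 < h)%N by rewrite prednK.
have w1 : (w.-1 < w)%N by rewrite prednK.
exists (mk_rect (w0 : 0 < w%:Z) (h0 : 0 < h%:Z)); split; rewrite /side_x /side_y ?subr0 //.
apply/rv_boxP; split=> //; exists r.
  split=> [u v uv|u v uv]; last by rewrite eE (unit_cells_visible bij_f cells uv).
  have : f u != f v by rewrite (can_eq fK).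
  rewrite -pair_eqE /pair_eq negb_and -!val_eqE /= /non_overlapping.
  have [ux1 ux2 uy1 uy2] := cells u; have [vx1 vx2 vy1 vy2] := cells v.
  by rewrite ux2 uy2 vx2 vy2 ux1 uy1 vx1 vy1; lia.
have cell (i : 'I_h) (j : 'I_w) : exists u, [/\ x1 (r u) = (j : nat), x2 (r u) = (j : nat)%:Z + 1,
    y1 (r u) = (i : nat) & y2 (r u) = (i : nat)%:Z + 1].
  by exists (g (i, j)); rewrite /r gK.
split=> [u|].
  have [-> -> -> ->] := cells u.
  by have := ltn_ord (f u).1; have := ltn_ord (f u).2; split; rewrite /x1 /x2 /y1 /y2 /=; lia.
have [u [ux1 _ uy1 _]] := cell (Ordinal h0) (Ordinal w0).
have [v [_ vx2 _ vy2]] := cell (Ordinal h1) (Ordinal w1).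
split; [exists u | exists v | exists u | exists v]; rewrite ?ux1 ?vx2 ?uy1 ?vy2 //.
  by rewrite /x2 /=; lia.
by rewrite /y2 /=; lia.
Qed.

End Graph.
End Boxes.

(** * Minima of sets of integers *)

Lemma minimumP (X : set int) : (X !=set0)%classic -> (forall x, X x -> 0 <= x) ->
  X (minimum X) /\ forall x, X x -> minimum X <= x.
Proof.
move=> [x0 Xx0] X_ge0.
have exX : exists k : nat, `[< X k%:Z >].
  by exists `|x0|%N; apply/asboolP; rewrite gez0_abs // X_ge0.
case: (ex_minnP exX) => k /asboolP Xk min_k.
suff: (X `&` lbound X)%classic (minimum X) by [].
apply: (@xgetPex _ 0); exists k%:Z; split=> // x Xx.
have x_ge0 := X_ge0 _ Xx.
by rewrite -(gez0_abs x_ge0) lez_nat; apply: min_k; rewrite gez0_abs //; apply/asboolP.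
Qed.

(** * Rounding square roots *)

Section SquareRoot.
Variables (R : realType) (n : nat).
Local Notation sqrtn := (Num.sqrt n%:R : R).

Lemma ceil_sqrt_le (w : int) : 0 <= w -> n%:Z <= w * w -> Num.ceil sqrtn <= w.
Proof.
move=> w0 nw; rewrite ceil_le_int -(ger0_norm (_ : 0 <= w%:~R)) ?ler0z //.
by rewrite -sqrtr_sqr ler_wsqrtr // expr2 -intrM pmulrn ler_int.
Qed.

(** With s = sqrt n, m its rounding and c its ceiling, the inequality
    (h + w)^2 >= 4 n gives 2 s <= h + w, where 2 s > 2 c - 2; this suffices when
    m < c.  When m = c one has 2 s >= 2 c - 1, and h + w = 2 c - 1 would force
    4 n = (2 c - 1)^2. *)
Lemma round_ceil_sqrt_le (h w : int) : 0 < h -> 0 < w -> n%:Z <= h * w ->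
  round sqrtn + Num.ceil sqrtn <= h + w.
Proof.
move=> h0 w0 nhw; rewrite /round.
set s := sqrtn; set m := Num.floor _; set c := Num.ceil _.
have s0 : 0 <= s by exact: sqrtr_ge0.
have ss : s * s = n%:~R by rewrite -expr2 sqr_sqrtr // ler0n.
have /andP[m_le m_gt] := floor_itv (s + 2^-1).
have /andP[c_lt c_ge] := ceil_itv s.
have {}nhw : s * s <= h%:~R * w%:~R by rewrite ss -intrM ler_int.
have h0R : 0 < h%:~R :> R by rewrite ltr0z.
have w0R : 0 < w%:~R :> R by rewrite ltr0z.
have two_s : 2 * s <= (h + w)%:~R.
  rewrite intrD leNgt; apply/negP => lt_s.
  have : 0 < (2 * s - (h%:~R + w%:~R)) * (2 * s + (h%:~R + w%:~R)).
    by apply: mulr_gt0; lra.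
  by have := sqr_ge0 (h%:~R - w%:~R : R); nra.
have c_le : c * 2 - 1 <= h + w.
  suff : (c - 1) * 2 < h + w by lia.
  by rewrite -(ltr_int R) intrM; lra.
have m_le_c : m <= c.
  by rewrite -ltzD1 -(ltr_int R) intrD; lra.
have [|mc] := ltP m c; first by lia.
have {mc m_le_c} mc : m = c by apply/le_anti; rewrite m_le_c.
rewrite mc; have [//|hw_lt] := leP (c + c) (h + w).
have hw : h + w = c * 2 - 1 by lia.
have sE : 2 * s = (c * 2 - 1)%:~R.
  move: two_s; rewrite hw -mc rmorphB rmorphM /=; lra.
have : n%:Z * 4 = (c * 2 - 1) * (c * 2 - 1).
  by apply/eqP; rewrite -(eqr_int R) 2!intrM -sE -ss; apply/eqP; ring.
by clear; lia.
Qed.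

End SquareRoot.

(** * The extremal bounds *)

Lemma minimum_box (R : realType) (T : finType) (e : rel T) (f : irect -> int) :
  (exists S : {fset irect}, rv_representation R e S) -> (forall B, 0 <= f B) ->
  let m := minimum (f @` rv_box R e)%classic in
  (exists2 B, rv_box R e B & f B = m) /\ forall B, rv_box R e B -> m <= f B.
Proof.
move=> [S rvS] f_ge0 /=; have [B0 rvB0] := rv_box_exists rvS.
have [] := @minimumP (f @` rv_box R e)%classic.
- by exists (f B0), B0.
- by move=> _ [B _ <-].
- by move=> [B rvB <-] le_m; split=> [|C rvC]; [exists B | apply: le_m; exists C].
Qed.

Lemma side_x_gt0 B : 0 < side_x B.
Proof. by rewrite subr_gt0 x_lt. Qed.

Lemma side_y_gt0 B : 0 < side_y B.
Proof. by rewrite subr_gt0 y_lt. Qed.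

Lemma path_graph_irr n : irreflexive (@path_graph n).
Proof. by move=> i; rewrite /path_graph orbb; lia. Qed.

Lemma visible_graph_iso (T T' : finType) (e : rel T) (e' : rel T') r f :
  irreflexive e -> irreflexive e' -> represents e r -> bijective f ->
  (forall u v, u != v -> visible r u v <-> e' (f u) (f v)) -> graph_iso e e'.
Proof.
move=> irr irr' [_ vis] bij_f visE; exists f; split=> // u v.
have [->|uv] := eqVneq u v; first by rewrite irr irr'.
by apply/idP/idP; rewrite vis // visE.
Qed.

Theorem theorem5p1 (R : realType) (T : finType) (e : rel T)
    (e_sym : symmetric e) (e_irr : irreflexive e) (n : nat) (card_T : #|T| = n)
    (has_rv : exists S : {fset irect}, rv_representation R e S) :
  let sqrtn : R := Num.sqrt n%:R in
  [/\ (1 <= height R e) /\ (height R e = 1 <-> graph_iso e (@path_graph n)),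
      (n%:Z <= area R e) /\
      (area R e = n%:Z <->
       exists h w : nat, [/\ (0 < h)%N, (0 < w)%N, n = (h * w)%N &
         graph_iso e (cart_prod (@path_graph h) (@path_graph w))]),
      (Num.ceil sqrtn <= width R e) /\
      (width R e = Num.ceil sqrtn <->
       in_F R e (Num.ceil sqrtn) (Num.ceil sqrtn)) &
      (2 * round sqrtn + 2 * Num.ceil sqrtn <= perim R e) /\
      (perim R e = 2 * round sqrtn + 2 * Num.ceil sqrtn <->
       exists h w : int, [/\ 0 < h, 0 < w,
         h + w = round sqrtn + Num.ceil sqrtn, n%:Z <= h * w & in_F R e h w])].
Proof.
subst n => sqrtn.
have sx := side_x_gt0; have sy := side_y_gt0.
have T0 : (0 < #|T|)%N by have [S /rv_representationP[]] := has_rv.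
have card_le B : rv_box R e B -> #|T|%:Z <= side_y B * side_x B.
  by rewrite mulrC; exact: rv_box_card.
split.
- have [|[B rvB hB] le_h] := minimum_box (f := box_height) has_rv.
    by move=> B; rewrite /box_height; have := sx B; have := sy B; lia.
  rewrite -/(height R e) in hB le_h.
  have h_ge1 : 1 <= height R e.
    by rewrite -hB /box_height; have := sx B; have := sy B; lia.
  split=> //; split=> [h1|[f [bij_f eE]]].
    have [C rvC C1] : exists2 C, rv_box R e C & side_y C = 1.
      move: hB; rewrite h1 /box_height minEle; case: ifP => _ B1; last by exists B.
      by exists (transpose B); [exact: rv_box_transpose | exact: B1].
    have [_ [r rep [inC _]]] := (rv_boxP R e C).1 rvC.
    have [f bij_f visE] := row_visible rep.1 inC C1.
    by apply: (visible_graph_iso e_irr _ rep bij_f) => //; exact: path_graph_irr.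
  (* A path is the grid with one row. *)
  have bij_g : bijective (fun u => (ord0 : 'I_1, f u)).
    have [g fK gK] := bij_f.
    by exists (g \o snd) => [u|[i j]] /=; [rewrite fK | rewrite gK (ord1 i)].
  have [|C [rvC _ C1]] := @grid_rv_box R T e _ _ _ T0 bij_g.
    by move=> u v; rewrite eE /cart_prod /= path_graph_irr andbF orbF.
  apply/le_anti; rewrite h_ge1 andbT; apply: le_trans (le_h _ rvC) _.
  by rewrite /box_height C1 ge_min lexx orbT.
- have [|[B rvB aB] le_a] := minimum_box (f := box_area) has_rv.
    by move=> B; apply: mulr_ge0; apply: ltW.
  rewrite -/(area R e) in aB le_a.
  have a_ge : #|T|%:Z <= area R e by rewrite -aB; exact: rv_box_card rvB.
  split=> //; split=> [a_eq|[h [w [h0 w0 hw [f [bij_f eE]]]]]].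
    have [_ [r rep [inB _]]] := (rv_boxP R e B).1 rvB.
    have [f bij_f cells] := full_box_unit_cells rep.1 inB (etrans aB a_eq).
    exists `|side_y B|%N, `|side_x B|%N; split.
    + by rewrite absz_gt0 gt_eqF.
    + by rewrite absz_gt0 gt_eqF.
    + by rewrite (bij_eq_card bij_f) card_prod !card_ord.
    + apply: (visible_graph_iso e_irr _ rep bij_f).
        by move=> [i j]; rewrite /cart_prod /= !path_graph_irr !andbF.
      by move=> u v uv; exact: unit_cells_visible cells uv.
  have [C [rvC Cx Cy]] := @grid_rv_box R T e _ _ _ T0 bij_f eE.
  apply/le_anti; rewrite a_ge andbT; apply: le_trans (le_a _ rvC) _.
  by rewrite /box_area Cx Cy hw mulrC PoszM.
- have [|[B rvB wB] le_w] := minimum_box (f := box_width) has_rv.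
    by move=> B; rewrite le_max ltW ?sx.
  rewrite -/(width R e) in wB le_w.
  have w_ge : Num.ceil sqrtn <= width R e.
    rewrite -wB /box_width; apply: ceil_sqrt_le; first by rewrite le_max ltW ?sx.
    apply: le_trans (card_le _ rvB) _.
    by rewrite ler_pM ?le_max ?lexx ?orbT // ltW ?sx ?sy.
  split=> //; split=> [w_eq|[C rvC wC]]; last first.
    apply/le_anti; rewrite w_ge andbT; apply: le_trans (le_w _ rvC) _.
    by rewrite /box_width ge_max; case: wC => -[-> ->]; rewrite lexx.
  (* A box attaining the width is padded along its shorter side to a square. *)
  rewrite -w_eq -wB /box_width; case: (leP (side_x B) (side_y B)) => le_xy.
    have le_xy' : 0 <= side_y B - side_x B by rewrite subr_ge0.
    have [C [rvC Cx Cy]] := rv_box_stretch le_xy' (rv_box_transpose rvB).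
    by exists C => //; left; split; [rewrite Cy addrC subrK | rewrite Cx].
  have le_yx : 0 <= side_x B - side_y B by rewrite subr_ge0 ltW.
  have [C [rvC Cx Cy]] := rv_box_stretch le_yx rvB.
  by exists C => //; left; split; rewrite ?Cx // Cy addrC subrK.
- have [|[B rvB pB] le_p] := minimum_box (f := box_perim) has_rv.
    by move=> B; rewrite /box_perim; have := sx B; have := sy B; lia.
  rewrite -/(perim R e) in pB le_p.
  have half_ge C : rv_box R e C -> round sqrtn + Num.ceil sqrtn <= side_y C + side_x C.
    by move=> rvC; apply: round_ceil_sqrt_le => //; exact: card_le.
  have p_ge : 2 * round sqrtn + 2 * Num.ceil sqrtn <= perim R e.
    by rewrite -pB /box_perim; have := half_ge _ rvB; lia.
  split=> //; split=> [p_eq|[h [w [_ _ hw _ [C rvC hwC]]]]].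
    exists (side_y B), (side_x B); split=> //; [|exact: card_le|by exists B; last left].
    by move: pB; rewrite p_eq /box_perim; lia.
  apply/le_anti; rewrite p_ge andbT; apply: le_trans (le_p _ rvC) _.
  by rewrite /box_perim; case: hwC => -[? ?]; lia.
Qed.
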